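(* Let $n\ge 2$. The random variable $\pi_1$ under $\mathcal{P}_n^{(q)}$ is strictly stochastically increasing in $q\in(0,\infty)$; specifically, if $0<q'<q''<\infty$, then $$\mathcal{P}_n^{(q')}(\pi_1\ge k)<\mathcal{P}_n^{(q'')}(\pi_1\ge k),\quad \text{for } k=2,\ldots,n.$$
   Context: Write $[n]=\{1,\ldots,n\}$ and let $S_n$ be the set of permutations of $[n]$, written in one-line notation $\sigma=\sigma_1\cdots\sigma_n$; $\sigma^{-1}_k$ is the position of $k$ in $\sigma$. A parking function of length $n$ is a sequence $\pi=(\pi_1,\ldots,\pi_n)\in[n]^n$ with $|\{i:\pi_i\le j\}|\ge j$ for all $j\in[n]$; $PF_n$ is the set of these. The inversion statistic is $I_n(\sigma)=\sum_{1\le i<j\le n}1_{\sigma_j<\sigma_i}$. For $j\in[n]$ let $I_{n,<j}(\sigma)=\sum_{1\le i<j}1_{\sigma^{-1}_j<\sigma^{-1}_i}$ (the number of inversions of $\sigma$ involving $j$ and a number less than $j$) and $\tilde I_{n,<j}=I_{n,<j}+1$. For $q\in(0,\infty)$, the Mallows measure on $S_n$ is $P_n^{(q)}(\sigma)=q^{I_n(\sigma)}/K_n$, where $K_n=\sum_{\rho\in S_n}q^{I_n(\rho)}$ is the normalizing constant; $P_n$ denotes the uniform measure on $S_n$. The map $(\sigma,\tau)\mapsto(\tilde I_{n,<\tau_1}(\sigma),\ldots,\tilde I_{n,<\tau_n}(\sigma))$ sends $S_n\times S_n$ into $PF_n$, and $\mathcal{P}_n^{(q)}$ denotes the probability measure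 on $PF_n$ that is the image of $P_n^{(q)}\times P_n$ under this map. $\pi_1$ denotes the first coordinate of the random parking function $\pi=(\pi_1,\ldots,\pi_n)\in PF_n$. *)

(* Defs.v *)
From mathcomp Require Import all_boot all_order all_algebra all_fingroup.
From mathcomp Require Import reals.

Set Implicit Arguments.
Unset Strict Implicit.
Unset Printing Implicit Defensive.

Import GRing.Theory.
Local Open Scope ring_scope.

(* A permutation s of [n] is an element of 'S_n: positions and letters are
   0-based (the ordinal i stands for i + 1), s i is the letter in position i,
   and (s^-1)%g k is the position of k.  Entries of parking functions are
   genuine 1-based values, hence they live in 'I_n.+1. *)

Definition parking n (p : {ffun 'I_n -> 'I_n.+1}) : bool :=
  [forall i, 0 < p i]%N &&
  [forall j : 'I_n.+1, (0 < j)%N ==> (j <= #|[set i | p i <= j]|)%N].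

Definition PF n := {p : {ffun 'I_n -> 'I_n.+1} | parking p}.

Definition pf_first n (n_gt0 : (0 < n)%N) (p : PF n) : nat :=
  val p (Ordinal n_gt0).

Definition inversions n (s : 'S_n) : nat :=
  (\sum_(i < n) \sum_(j < n | i < j) (s j < s i))%N.

Definition inversions_lt n (j : 'I_n) (s : 'S_n) : nat :=
  (\sum_(i < n | i < j) ((s^-1)%g j < (s^-1)%g i))%N.

Definition tinversions_lt n (j : 'I_n) (s : 'S_n) : nat := (inversions_lt j s).+1.

Lemma tinversions_lt_le n (j : 'I_n) (s : 'S_n) : (tinversions_lt j s <= j.+1)%N.
Proof.
rewrite /tinversions_lt ltnS /inversions_lt.
apply: (@leq_trans (\sum_(i < n | i < j) 1)%N).
  by apply: leq_sum => i _; apply: leq_b1.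
rewrite -(big_ord_widen n (fun=> 1%N) (ltnW (ltn_ord j))).
by rewrite sum1_card card_ord.
Qed.

Lemma tinversions_lt_bound n (j : 'I_n) (s : 'S_n) : (tinversions_lt j s < n.+1)%N.
Proof. by rewrite ltnS (leq_trans (tinversions_lt_le j s)). Qed.

Definition pf_fun n (st : 'S_n * 'S_n) : {ffun 'I_n -> 'I_n.+1} :=
  [ffun i => Ordinal (tinversions_lt_bound (st.2 i) st.1)].

Lemma pf_funP n (st : 'S_n * 'S_n) : parking (pf_fun st).
Proof.
apply/andP; split; first by apply/forallP => i; rewrite ffunE.
apply/forallP => j; apply/implyP => j_gt0.
apply: (@leq_trans #|[set i | st.2 i < j]%N|); last first.
  apply: subset_leq_card; apply/subsetP => i; rewrite !inE ffunE /=.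
  exact/leq_trans/tinversions_lt_le.
have -> : [set i | st.2 i < j]%N = st.2 @^-1: [set x : 'I_n | x < j]%N.
  by apply/setP => i; rewrite !inE.
rewrite card_preimset; last exact: perm_inj.
have jn : (j <= n)%N by rewrite -ltnS.
rewrite -sum1_card (eq_bigl (fun x : 'I_n => x < j)%N); last first.
  by move=> x; rewrite inE.
by rewrite -(big_ord_widen n (fun=> 1%N) jn) sum1_card card_ord.
Qed.

Definition pf_map n (st : 'S_n * 'S_n) : PF n :=
  exist (fun p => parking p) (pf_fun st) (pf_funP st).

(* Probability measures on a finite type are given by their mass functions. *)
Section Measures.
Variable R : realType.

Definition prob (T : finType) (P : T -> R) (A : {set T}) : R :=
  \sum_(x in A) P x.

Definition pushforward (T U : finType) (f : T -> U) (P : T -> R) : U -> R :=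
  fun y => prob P [set x | f x == y].

Definition product_measure (T U : finType) (P : T -> R) (Q : U -> R) :
    T * U -> R :=
  fun x => P x.1 * Q x.2.

Definition mallows n (q : R) : 'S_n -> R :=
  fun s => q ^+ inversions s / \sum_(r : 'S_n) q ^+ inversions r.

Definition uniform n : 'S_n -> R := fun=> (#|{: 'S_n}|%:R)^-1.

Definition mallows_pf n (q : R) : PF n -> R :=
  pushforward (@pf_map n) (product_measure (@mallows n q) (@uniform n)).

End Measures.

(* Main.v *)
Require Import Defs.
From mathcomp Require Import all_boot all_order all_algebra all_fingroup.
From mathcomp Require Import reals.
Local Open Scope ring_scope.

Import Order.TTheory GRing.Theory Num.Theory.

(** Conditionally on [tau], the event is [k - 1 <= I_{<j}] with [j = tau_1].
    The statistics [I_{<j}] form a Lehmer code: they sum to the number of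
    inversions and give a bijection from the permutations onto the sequences
    [c] with [c j <= j].  So under the Mallows measure [I_{<j}] is a truncated
    geometric variable, with mass proportional to [q ^ x] on [0 .. j], whose
    upper tails increase with [q], strictly so if [k - 1 <= j]; this happens
    for [j] the largest letter. *)

Section LehmerCode.
Variable n : nat.

Lemma inversions_lt_ltn (j : 'I_n) (s : 'S_n) : (inversions_lt j s < n)%N.
Proof.
have le_j : (inversions_lt j s <= j)%N := tinversions_lt_le j s.
exact: leq_ltn_trans le_j (ltn_ord j).
Qed.

Definition code (s : 'S_n) : {ffun 'I_n -> 'I_n} :=
  [ffun j => Ordinal (inversions_lt_ltn j s)].

(** Writing the bound [c j <= j] as a [family] over one common codomain lets a product of sums be
    expanded over [codes]. *)
Definition codes : pred {ffun 'I_n -> 'I_n} :=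
  family (fun j : 'I_n => [pred x : 'I_n | (x <= j)%N]).

Lemma code_in s : code s \in codes.
Proof. by apply/familyP => j; rewrite ffunE inE /=; apply: tinversions_lt_le. Qed.

Lemma inversions_ltE (j : 'I_n) (s : 'S_n) :
  inversions_lt j s = #|[set i : 'I_n | (i < j)%N & ((s^-1)%g j < (s^-1)%g i)%N]|.
Proof.
rewrite -sum1_card /inversions_lt big_mkcond [RHS]big_mkcond /=.
by apply: eq_bigr => i _; rewrite inE; do 2 case: ltnP.
Qed.

(** Each inversion is counted once, at the larger of its two letters. Reindexing positions by
    letters swaps the summation condition with the summand. *)
Lemma inversionsE (s : 'S_n) : inversions s = (\sum_(j < n) inversions_lt j s)%N.
Proof.
rewrite /inversions (reindex_inj (@perm_inj _ (s^-1)%g)) /=.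
apply: eq_bigr => j _; rewrite (reindex_inj (@perm_inj _ (s^-1)%g)) /=.
rewrite big_mkcond /inversions_lt [RHS]big_mkcond; apply: eq_bigr => i _ /=.
by rewrite !permKV; do 2 case: ltnP.
Qed.

(** With 0-based values, [u i] is the number of places carrying a smaller value, so the order
    pattern recovers [u]. *)
Lemma perm_ltn_inj (s t : 'S_n) :
  (forall i j, (s i < s j)%N = (t i < t j)%N) -> s = t.
Proof.
have posE (u : 'S_n) i : u i = #|[set k | u k < u i]%N| :> nat.
  have -> : [set k | u k < u i]%N = u @^-1: [set x : 'I_n | x < u i]%N.
    by apply/setP => k; rewrite !inE.
  rewrite card_preimset; last exact: perm_inj.
  rewrite -sum1_card (eq_bigl (fun x : 'I_n => x < u i)%N); last first.
    by move=> x; rewrite inE.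
  by rewrite -(big_ord_widen n (fun=> 1%N) (ltnW (ltn_ord (u i))))
    sum1_card card_ord.
move=> st; apply/permP => i; apply/val_inj; rewrite /= posE [RHS]posE.
by congr #|pred_of_set _|; apply/setP => k; rewrite !inE st.
Qed.

(* Both sets of larger predecessors of [j] are up-closed for the same linear
   order on the letters below [j], hence equal as soon as equinumerous. *)
Lemma code_inj : injective code.
Proof.
move=> s t st; apply: invg_inj.
(* [m] bounds the larger letter: the relative order of all letters below [j] is known when [j] is
   treated. *)
have ord_lt m : forall i j : 'I_n, (j < m)%N -> (i < j)%N ->
    ((s^-1)%g j < (s^-1)%g i)%N = ((t^-1)%g j < (t^-1)%g i)%N.
  elim: m => // m IH i j jm ij.
  pose U (u : 'S_n) :=
    [set i : 'I_n | (i < j)%N & ((u^-1)%g j < (u^-1)%g i)%N].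
  have cardU : #|U s| = #|U t|.
    by have /ffunP/(_ j)/(congr1 val) := st; rewrite !ffunE /= !inversions_ltE.
  suff /setP/(_ i) : U s = U t by rewrite !inE ij.
  apply/eqP; rewrite eqEcard cardU leqnn andbT.
  apply: contraT => /subsetPn[a aUs aUt].
  have /subsetPn[b bUt bUs] : ~~ (U t \subset U s).
    apply: contra aUt => tUs.
    by have /eqP -> : U t == U s by rewrite eqEcard tUs cardU leqnn.
  move: aUs aUt bUt bUs; rewrite !inE => /andP[aj ja]; rewrite aj /= -leqNgt.
  move=> ta /andP[bj jb]; rewrite bj /= -leqNgt => sb.
  (* [j] separates [a] from [b] in opposite ways: [b] precedes [a] in [s] but follows it in [t],
     against [IH]. *)
  have s_ba := leq_ltn_trans sb ja; have t_ab := leq_ltn_trans ta jb.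
  have [ab|ba|/val_inj ab] := ltngtP a b.
  - by have := IH a b (leq_trans bj jm) ab; rewrite s_ba ltnNge ltnW.
  - by have := IH b a (leq_trans aj jm) ba; rewrite t_ab ltnNge ltnW.
  - by move: s_ba; rewrite ab ltnn.
have neq (u : 'S_n) i j : i != j -> (u i < u j)%N = ~~ (u j < u i)%N.
  move=> ij.
  by rewrite ltnNge leq_eqVlt val_eqE (inj_eq perm_inj) eq_sym (negPf ij).
apply: perm_ltn_inj => i j; have [ij|ji|/val_inj ->] := ltngtP i j.
- by rewrite !(neq _ i j) ?(ord_lt n) // -val_eqE neq_ltn ij.
- exact: (ord_lt n).
- by rewrite !ltnn.
Qed.

(** Given injectivity, counting suffices: there are [j.+1] choices at each [j], hence [n]! codes. *)
Lemma codom_code : [set code s | s : 'S_n] = [set c in codes].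
Proof.
apply/eqP; rewrite eqEcard; apply/andP; split.
  by apply/subsetP => _ /imsetP[s _ ->]; rewrite inE code_in.
rewrite card_imset ?cardsE; last exact: code_inj.
rewrite card_Sn card_family foldrE big_map big_enum /=.
rewrite fact_prod big_add1 /= big_mkord leq_eqVlt; apply/orP; left; apply/eqP.
apply: eq_bigr => j _; rewrite -sum1_card.
rewrite (eq_bigl (fun x : 'I_n => x < j.+1)%N) //.
by rewrite -(big_ord_widen n (fun=> 1%N) (ltn_ord j)) sum1_card card_ord.
Qed.

(** This factorization expresses the independence of the code entries, for weights that are products
    over the entries. *)
Lemma sum_code (R : comNzRingType) (F : 'I_n -> 'I_n -> R) :
  \sum_(s : 'S_n) \prod_j F j (code s j) =
  \prod_(j < n) \sum_(x < n | (x <= j)%N) F j x.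
Proof.
rewrite bigA_distr_big_dep.
rewrite -[LHS](big_imset (fun c : {ffun 'I_n -> 'I_n} => \prod_j F j (c j))) /=;
  last by move=> s t _ _; apply: code_inj.
by apply: eq_bigl => c; rewrite codom_code inE.
Qed.

End LehmerCode.

Lemma prob_pushforward (R : realType) (T U : finType) (f : T -> U) (P : T -> R)
    (A : {set U}) :
  prob (pushforward f P) A = \sum_(x | f x \in A) P x.
Proof.
rewrite /prob /pushforward (partition_big f (mem A)) //=.
apply: eq_bigr => y yA; rewrite /prob; apply: eq_bigl => x; rewrite inE.
by case: eqP => [->|]; rewrite ?yA ?andbF.
Qed.

Section TruncatedGeometric.
Variables (R : realType) (n : nat).
Implicit Types (q : R) (k : nat) (j : 'I_n).

(** The upper tail of the truncated geometric law on [0 .. j]; the successor in [k <= x.+1] is the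
    shift from [inversions_lt] to [tinversions_lt]. *)
Definition tail q k j : R :=
  (\sum_(x < n | (x <= j)%N && (k <= x.+1)%N) q ^+ x) /
  (\sum_(x < n | (x <= j)%N) q ^+ x).

Lemma sum_expr_gt0 q (P : pred 'I_n) j : 0 < q -> P j ->
  0 < \sum_(x < n | P x) q ^+ x.
Proof.
move=> q0 Pj; rewrite (bigD1 j) //= ltr_pwDl ?exprn_gt0 //.
by apply: sumr_ge0 => x _; rewrite exprn_ge0 ?ltW.
Qed.

Lemma mallows_tail q k j : 0 < q ->
  \sum_(s : 'S_n | (k <= tinversions_lt j s)%N) mallows q s = tail q k j.
Proof.
move=> q0; rewrite /mallows -mulr_suml.
have expE s : q ^+ inversions s = \prod_(i < n) q ^+ code n s i.
  by rewrite inversionsE -prodrXr; apply: eq_bigr => i _; rewrite ffunE.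
(* The indicator of the event goes into the factor at [j]; all other factors then cancel against the
   normalizing constant. *)
pose F (i x : 'I_n) : R := if i == j then q ^+ x *+ (k <= x.+1)%N else q ^+ x.
have -> : \sum_(s : 'S_n | (k <= tinversions_lt j s)%N) q ^+ inversions s =
    \sum_(s : 'S_n) \prod_i F i (code n s i).
  rewrite big_mkcond; apply: eq_bigr => s _.
  rewrite [RHS](bigD1 j) //= {1}/F eqxx expE (bigD1 j) //=.
  have -> : \prod_(i < n | i != j) F i (code n s i) =
      \prod_(i < n | i != j) q ^+ code n s i.
    by apply: eq_bigr => i /negPf ij; rewrite /F ij.
  by rewrite ffunE /= /tinversions_lt; case: ifP; rewrite ?mul0r.
under [X in _ / X]eq_bigr do rewrite expE.
rewrite (sum_code n R F) (sum_code n R (fun _ x => q ^+ x)).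
rewrite (bigD1 j) //= [X in _ / X](bigD1 j) //=.
have -> : \prod_(i < n | i != j) \sum_(x < n | (x <= i)%N) F i x =
    \prod_(i < n | i != j) \sum_(x < n | (x <= i)%N) q ^+ x.
  by apply: eq_bigr => i /negPf ij; rewrite /F ij.
rewrite -mulf_div divff ?mulr1; last first.
  by rewrite lt0r_neq0 // prodr_gt0 // => i _; apply: (sum_expr_gt0 _ _ i).
congr (_ / _); rewrite big_mkcondr /=; apply: eq_bigr => x _.
by rewrite /F eqxx; case: leqP.
Qed.

(** With [A] the tail sum and [B] the rest of the normalizer, cross-multiplying leaves
    [A p * B q < A q * B p]. This holds term by term, as exponents in [A] exceed those in [B]. *)
Lemma tail_lt p q k j : 0 < p -> p < q -> (2 <= k <= j.+1)%N ->
  tail p k j < tail q k j.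
Proof.
move=> p0 pq /andP[k2 kj]; have q0 := lt_trans p0 pq.
have n0 : (0 < n)%N by apply: leq_ltn_trans (ltn_ord j).
pose A r : R := \sum_(x < n | (x <= j)%N && (k <= x.+1)%N) r ^+ x.
pose B r : R := \sum_(x < n | (x <= j)%N && ~~ (k <= x.+1)%N) r ^+ x.
have ABE r : tail r k j = A r / (A r + B r).
  by rewrite /tail [X in _ / X](bigID (fun x : 'I_n => k <= x.+1)%N).
have A0 r : 0 < r -> 0 < A r.
  by move=> r0; apply: (sum_expr_gt0 _ _ j) => //; rewrite leqnn.
have B0 r : 0 < r -> 0 < B r.
  move=> r0; apply: (sum_expr_gt0 _ _ (Ordinal n0)) => //=.
  by rewrite -ltnNge.
rewrite !ABE ltr_pdivrMr ?addr_gt0 ?A0 ?B0 // mulrAC.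
rewrite ltr_pdivlMr ?addr_gt0 ?A0 ?B0 //.
rewrite !mulrDr [A q * A p]mulrC ltrD2l /A /B !big_distrlr /=.
(* Strictness needs nonempty ranges: [j] lies in the tail as [k <= j.+1], and 0 lies outside it as
   [2 <= k]. *)
have has_A : has (fun x : 'I_n => (x <= j)%N && (k <= x.+1)%N)
    (index_enum 'I_n).
  by apply/hasP; exists j; rewrite ?mem_index_enum // leqnn.
have has_B : has (fun x : 'I_n => (x <= j)%N && ~~ (k <= x.+1)%N)
    (index_enum 'I_n).
  by apply/hasP; exists (Ordinal n0); rewrite ?mem_index_enum //= -ltnNge.
apply: ltr_sum => // x /andP[_ kx]; apply: ltr_sum => // y /andP[_ ky].
have yx : (y < x)%N by rewrite -ltnS (leq_trans _ kx) // ltnNge.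
(* Cancelling [p ^+ y * q ^+ y] leaves the comparison of the powers with exponent [x - y], which is
   positive. *)
rewrite -(subnK (ltnW yx)) !exprD -!mulrA [q ^+ y * _]mulrC.
by rewrite ltr_pM2r ?mulr_gt0 ?exprn_gt0 // ltrXn2r ?subn_eq0 -?ltnNge ?ltW.
Qed.

Lemma tail_le p q k j : 0 < p -> p < q -> (2 <= k)%N -> tail p k j <= tail q k j.
Proof.
move=> p0 pq k2; have [kj|jk] := leqP k j.+1; first by rewrite ltW ?tail_lt ?k2.
have tail0 r : tail r k j = 0.
  rewrite /tail big_pred0 ?mul0r // => x.
  by case: (leqP x j) => //= xj; apply/negbTE; rewrite -ltnNge (leq_ltn_trans _ jk).
by rewrite !tail0.
Qed.

Lemma prob_mallows_pf_first (n_gt0 : (0 < n)%N) q k : 0 < q ->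
  prob (mallows_pf q) [set p : PF n | (k <= pf_first n_gt0 p)%N] =
  \sum_(t : 'S_n) tail q k (t (Ordinal n_gt0)) / #|{: 'S_n}|%:R.
Proof.
move=> q0; rewrite /mallows_pf prob_pushforward /product_measure /uniform.
(* The vacuous [true] gives the condition the shape needed to split the sum over pairs. *)
rewrite (eq_bigl (fun st : 'S_n * 'S_n =>
    true && (k <= tinversions_lt (st.2 (Ordinal n_gt0)) st.1)%N)); last first.
  by move=> st; rewrite inE /pf_first /= ffunE.
rewrite -(pair_big_dep xpredT
  (fun s t : 'S_n => k <= tinversions_lt (t (Ordinal n_gt0)) s)%N
  (fun s t : 'S_n => mallows q s / #|{: 'S_n}|%:R)) /=.
rewrite (exchange_big_dep xpredT) //=; apply: eq_bigr => t _.
by rewrite -mulr_suml mallows_tail.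
Qed.

End TruncatedGeometric.

Theorem proposition1 (R : realType) (n : nat) (hn : (2 <= n)%N)
    (q' q'' : R) (hq' : 0 < q') (hq : q' < q'')
    (k : nat) (hk : (2 <= k <= n)%N) :
  prob (mallows_pf q') [set p : PF n | (k <= pf_first (ltnW hn) p)%N] <
  prob (mallows_pf q'') [set p : PF n | (k <= pf_first (ltnW hn) p)%N].
Proof.
have /andP[k2 kn] := hk; have hq'' := lt_trans hq' hq.
rewrite !prob_mallows_pf_first //.
set i0 := Ordinal _; have n1 : (n.-1 < n)%N by rewrite prednK // ltnW.
have card_gt0 : 0 < #|{: 'S_n}|%:R^-1 :> R.
  by rewrite invr_gt0 ltr0n; apply/card_gt0P; exists 1%g.
(* [t1] puts the largest letter first, where [k <= n] makes the tail inequality strict; the other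
   terms compare weakly. *)
pose t1 := tperm i0 (Ordinal n1).
rewrite (bigD1 t1) //= [ltRHS](bigD1 t1) //= ltr_leD //.
  by rewrite ltr_pM2r // tpermL tail_lt //= prednK ?k2 // ltnW.
by apply: ler_sum => t _; rewrite ler_pM2r // tail_le.
Qed.
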